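(* Let $H$ be a finite hypergraph as in the context, and let $x(n)$ be the Pólya urn process on $H$. If the restriction of the incidence matrix $I(H)$ to $\Gamma$ is injective (i.e. $K=\{0\}$), then there exists a point $v=v(H)\in\Delta^{m-1}$, depending only on $H$, such that $x(n)$ converges to $v$ almost surely.
   Context: Let $H=(V,E)$ be a finite hypergraph with vertex set $V=[m]=\{1,\dots,m\}$ and a set $E$ of $N\ge 1$ hyperedges (nonempty subsets of $[m]$), such that every vertex belongs to at least one hyperedge. Pólya urn on $H$: initially vertex $i$ holds $B_i(0)\ge 1$ balls; $N_0=\sum_{i=1}^m B_i(0)$. At each step $n\ge 1$, for each hyperedge $I\in E$ (independently across hyperedges, conditionally on the past) one ball is added to a vertex $i\in I$ chosen with probability $B_i(n-1)/\sum_{j\in I}B_j(n-1)$, where $B_i(n)$ denotes the number of balls at vertex $i$ after step $n$. Put $x_i(n)=B_i(n)/(N_0+nN)$ and $x(n)=(x_1(n),\dots,x_m(n))$. Notation: $\Delta^{m-1}=\{x\in\mathbb R^m: x_i\ge 0,\ \sum_i x_i=1\}$; $\Gamma=\{x\in\mathbb R^m:\sum_i x_i=0\}$; the incidence matrix $I(H)$ is the $N\times m$ matrix indexed by $E\times[m]$ with entry $(I,i)$ equal to $1$ if $i\in I$ and $0$ otherwise; $K=\ker(I(H)|_\Gamma)=\{w\in\Gamma: \sum_{i\in I}w_i=0\ \forall I\in E\}$. *)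

(* Defs.v *)
From HB Require Import structures.
From mathcomp Require Import all_boot all_order all_algebra.
From mathcomp Require Import all_classical all_reals all_analysis.
Set Implicit Arguments. Unset Strict Implicit. Unset Printing Implicit Defensive.
Import Order.TTheory GRing.Theory Num.Theory.
Import numFieldNormedType.Exports.
Local Open Scope classical_set_scope.
Local Open Scope ring_scope.

Definition config (m : nat) := {ffun 'I_m -> nat}.

Definition is_hypergraph (m : nat) (E : {set {set 'I_m}}) : Prop :=
  (0 < #|E|)%N /\ (forall I, I \in E -> (0 < #|I|)%N) /\
  (forall i : 'I_m, exists2 I, I \in E & i \in I).

Definition kernel_trivial (R : realType) (m : nat) (E : {set {set 'I_m}}) : Prop :=
  forall w : 'I_m -> R, \sum_i w i = 0 ->
    (forall I, I \in E -> \sum_(i in I) w i = 0) -> forall i, w i = 0.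

(* A choice function c selects, for each hyperedge I in E, the vertex of I
   receiving the new ball; it is None outside E. *)
Definition valid_choice (m : nat) (E : {set {set 'I_m}})
  (c : {ffun {set 'I_m} -> option 'I_m}) : bool :=
  [forall I, if I \in E then (if c I is Some i then i \in I else false)
             else c I == None].

Definition add_balls (m : nat) (E : {set {set 'I_m}}) (b : config m)
  (c : {ffun {set 'I_m} -> option 'I_m}) : config m :=
  [ffun i => b i + #|[set I in E | c I == Some i]|]%N.

Definition choice_prob (R : realType) (m : nat) (E : {set {set 'I_m}})
  (b : config m) (c : {ffun {set 'I_m} -> option 'I_m}) : R :=
  \prod_(I in E) (if c I is Some i then (b i)%:R / (\sum_(j in I) b j)%:R else 0).

Definition urn_trans (R : realType) (m : nat) (E : {set {set 'I_m}})
  (b b' : config m) : R :=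
  \sum_(c | valid_choice E c && (add_balls E b c == b')) choice_prob R E b c.

(* (B n)_n is the Polya urn process on (E) started at B0, on the probability
   space P: each B n is a random variable (measurable, countable range) and the
   finite-dimensional laws are those of the Markov chain with initial state B0
   and transition probabilities urn_trans. *)
Definition is_polya_urn (R : realType) (d : measure_display) (T : measurableType d)
  (P : probability T R) (m : nat) (E : {set {set 'I_m}}) (B0 : config m)
  (B : nat -> T -> config m) : Prop :=
  (forall n (b : config m), measurable [set w | B n w = b]) /\
  (forall n (bs : nat -> config m),
      P [set w | forall k, (k <= n)%N -> B k w = bs k] =
      (((bs 0%N == B0)%:R * \prod_(k < n) urn_trans R E (bs k) (bs k.+1)) : R)%:E).

Definition urn_x (R : realType) (m : nat) (E : {set {set 'I_m}}) (B0 : config m)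
  (b : config m) (n : nat) (i : 'I_m) : R :=
  (b i)%:R / ((\sum_j B0 j)%N + n * #|E|)%:R.

Definition in_simplex (R : realType) (m : nat) (v : 'I_m -> R) : Prop :=
  (forall i, 0 <= v i) /\ \sum_i v i = 1.

(* Main.v *)
(* With [x_I = \sum_(i in I) x i], let [v] maximise [\prod_I x_I] over the
   simplex. The first-order condition [\sum_I x_I / v_I <= #|E|] together with
   [v_I / x_I + x_I / v_I - 2 >= (x_I - v_I) ^+ 2] makes a corrected relative
   entropy of [x(n)] with respect to [v] a nonnegative supermartingale with drift
   at most [- \sum_I (x_I(n) - v_I) ^+ 2 / (N_0 + n N)], so these terms have a
   finite sum almost surely. Since [x_I(n)] moves by [O(1/n)] at step [n] and the
   harmonic series diverges, [x_I(n)] converges to [v_I] for each hyperedge [I];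
   as the kernel is trivial, [x(n)] is an affine function of the [x_I(n)] and
   converges to [v]. *)
Require Import Defs.
From HB Require Import structures.
From mathcomp Require Import all_boot all_order all_algebra.
From mathcomp Require Import all_classical all_reals all_analysis.
From mathcomp Require Import measurable_realfun.
From mathcomp Require Import ring lra.
Set Implicit Arguments. Unset Strict Implicit. Unset Printing Implicit Defensive.
Import Order.TTheory GRing.Theory Num.Theory.
Import numFieldNormedType.Exports.
Local Open Scope classical_set_scope.
Local Open Scope ring_scope.

(** * Real analysis: derivatives of finite products, and a convergence criterion *)

(** First-order expansion at [t = 0], with [C] independent of [t]; it replaces differentiation of
    the product along a segment. *)
Lemma prod1DM_approx (R : realFieldType) (I : Type) (r : seq I) (a : I -> R) :
  exists2 C, 0 <= C & forall t, 0 <= t <= 1 ->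
    `|\prod_(i <- r) (1 + t * a i) - 1 - t * \sum_(i <- r) a i| <= C * t ^+ 2.
Proof.
elim: r => [|i r [C C0 IH]].
  exists 0 => // t _; rewrite !big_nil; have -> : 1 - 1 - t * 0 = 0 :> R by ring.
  by rewrite normr0 mul0r.
set S := \sum_(j <- r) a j in IH *.
exists ((1 + `|a i|) * C + `|a i * S|).
  by rewrite addr_ge0// mulr_ge0// addr_ge0.
move=> t /andP[t0 t1]; rewrite !big_cons -/S.
set p := \prod_(j <- r) _.
have -> : (1 + t * a i) * p - 1 - t * (a i + S) =
  (1 + t * a i) * (p - 1 - t * S) + t ^+ 2 * (a i * S) by ring.
rewrite (le_trans (ler_normD _ _))// [leRHS]mulrDl lerD//; last first.
  by rewrite normrM ger0_norm ?sqr_ge0// mulrC.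
rewrite normrM -mulrA ler_pM//; last by apply: IH; rewrite t0.
rewrite (le_trans (ler_normD _ _))// normr1 lerD2l normrM ger0_norm//.
exact: ler_piMl.
Qed.

(** The sum is the derivative at 0 of a product that is largest at [t = 0]. *)
Lemma sum_le0_prod1DM_le1 (R : realFieldType) (I : Type) (r : seq I) (a : I -> R) :
  (forall t, 0 <= t <= 1 -> \prod_(i <- r) (1 + t * a i) <= 1) ->
  \sum_(i <- r) a i <= 0.
Proof.
move=> le1; have [C C0 approx] := prod1DM_approx r a.
set S := \sum_(i <- r) a i in approx *; rewrite leNgt; apply/negP => S0.
have CS0 : 0 < C + S by rewrite ltr_wpDl.
(* With [t = S / (C + S)] one has [C * t < S], so the linear term [t * S] beats the error
   [C * t ^+ 2] and the product would exceed 1. *)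
have t01 : 0 <= S / (C + S) <= 1.
  by rewrite ler_pdivrMr// mul1r lerDr C0 andbT divr_ge0// ltW.
have := approx _ t01; have := le1 _ t01; move: t01.
set t := S / (C + S) => /andP[t0 t1] p1.
rewrite ler_norml => /andP[+ _]; rewrite -/t => low.
have tS : t * (C + S) = S by rewrite /t divfK// gt_eqF.
have tpos : 0 < t by rewrite divr_gt0.
have : t * S <= t * (C * t) by rewrite expr2 in low; lra.
rewrite ler_pM2l// => SCt.
have : C * t < S.
  by rewrite -tS mulrC mulrDr ltrDl mulr_gt0.
by lra.
Qed.

Lemma cvgn_bounded_sum (R : realType) (u : R ^nat) (C : R) :
  (forall n, 0 <= u n) -> (forall n, \sum_(0 <= k < n) u k <= C) ->
  cvgn (series u).
Proof.
move=> u0 uC; apply: nondecreasing_is_cvgn.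
  by apply/nondecreasing_seqP => n; rewrite /series/= big_nat_recr//= lerDl.
by exists C => _ [n _ <-]; exact: uC.
Qed.

(* The increments of [y ^+ 3] are summable, since they are [O(y ^+ 2 / t)];
   its limit must vanish because [1 / t] is not summable. *)
Lemma cvg0_weighted_square_sum (R : realType) (y t : R ^nat) (A C K : R) :
  (forall n, 0 < t n) -> (forall n, t n <= K * n.+1%:R) ->
  (forall n, `|y n| <= 1) ->
  (forall n, `|y n.+1 - y n| <= C / t n) ->
  (forall n, `|y n.+1 - y n| <= C / t n.+1) ->
  (forall n, \sum_(0 <= k < n) y k ^+ 2 / t k <= A) ->
  y @ \oo --> 0.
Proof.
move=> t0 tK y1 dy dy' yA.
have K0 : 0 < K by have := lt_le_trans (t0 0%N) (tK 0%N); rewrite mulr1.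
have C0 : 0 <= C.
  by have := le_trans (normr_ge0 _) (dy 0%N); rewrite pmulr_lge0 ?invr_gt0.
have q0 n : 0 <= y n ^+ 2 / t n by rewrite divr_ge0 ?sqr_ge0 ?ltW.
pose cube n := y n ^+ 3.
have incr n : `|cube n.+1 - cube n| <=
    C * (3 / 2) * (y n ^+ 2 / t n + y n.+1 ^+ 2 / t n.+1).
  have -> : cube n.+1 - cube n =
    (y n.+1 - y n) * (y n ^+ 2 + y n * y n.+1 + y n.+1 ^+ 2).
    by rewrite /cube; ring.
  have ge0 : 0 <= y n ^+ 2 + y n * y n.+1 + y n.+1 ^+ 2.
    by move: (y n) (y n.+1) => a b; have := sqr_ge0 (a + b); nra.
  rewrite normrM (ger0_norm ge0).
  have le : y n ^+ 2 + y n * y n.+1 + y n.+1 ^+ 2 <=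
    3 / 2 * y n ^+ 2 + 3 / 2 * y n.+1 ^+ 2.
    by move: (y n) (y n.+1) => a b; have := sqr_ge0 (a - b); nra.
  rewrite (le_trans (ler_wpM2l (normr_ge0 _) le))// mulrDr.
  (* Each square is paired with the increment bound having its own denominator, hence the two
     hypotheses on increments. *)
  have -> : C * (3 / 2) * (y n ^+ 2 / t n + y n.+1 ^+ 2 / t n.+1) =
    C / t n * (3 / 2 * y n ^+ 2) + C / t n.+1 * (3 / 2 * y n.+1 ^+ 2) by ring.
  by rewrite lerD// ler_wpM2r// mulr_ge0 ?sqr_ge0.
have /cvg_ex[/= l cubel] : cvgn cube.
  have /normed_cvg : cvgn [normed series (telescope cube)].
    apply: (@cvgn_bounded_sum _ _ (C * (3 / 2) * (A + A))) => n /=.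
      exact: normr_ge0.
    apply: (le_trans (ler_sum _ (fun k _ => incr k))).
    rewrite -mulr_sumr ler_wpM2l ?mulr_ge0// big_split/= lerD//.
    apply: le_trans (yA n.+1); rewrite big_nat_recl//.
    by rewrite lerDr.
  move=> sc; have -> : cube = cst (cube 0%N) + series (telescope cube).
    by apply/funext => n; rewrite [LHS]eq_sum_telescope.
  by apply: is_cvgD => //; exact: is_cvg_cst.
have l0 : l = 0.
  apply/eqP/negPn/negP => l_neq0.
  have h0 : 0 < `|l| / 2 by rewrite divr_gt0// normr_gt0.
  have /cvgrPdist_lt : (fun n => `|cube n|) @ \oo --> `|l| by exact: cvg_norm.
  move=> /(_ _ h0) [N _ HN].
  (* Past [N], [y k ^+ 2 >= |y k| ^+ 3 >= |l| / 2], so [1 / k.+1] is at most a constant times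
     [y k ^+ 2 / t k] and the harmonic series would converge. *)
  apply: (@dvg_harmonic R); rewrite -(@is_cvg_series_restrict N).
  apply: nondecreasing_is_cvgn.
    apply/nondecreasing_seqP => n; have [Nn|nN] := leqP N n.
      by rewrite /= [leRHS]big_nat_recr//= lerDl invr_ge0.
    by rewrite /= big_geq ?sumr_ge0// ltnW.
  exists ((`|l| / 2)^-1 * K * A) => _ [n _ <-].
  apply: (@le_trans _ _ (\sum_(N <= k < n) (`|l| / 2)^-1 * K * (y k ^+ 2 / t k))).
    rewrite /=; apply: ler_sum_nat => k /andP[Nk _].
    have := HN k Nk => /=; rewrite /cube => dist.
    have lk : `|l| / 2 <= y k ^+ 2.
      have : `|y k ^+ 3| <= y k ^+ 2.
        by rewrite exprSr normrM ger0_norm ?sqr_ge0// ler_piMr ?sqr_ge0.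
      by move: dist; rewrite ltr_norml => /andP[_]; lra.
    have -> : (`|l| / 2)^-1 * K * (y k ^+ 2 / t k) =
      ((`|l| / 2)^-1 * y k ^+ 2) * (K / t k) by ring.
    rewrite -[leLHS]mul1r ler_pM//.
      by rewrite mulrC ler_pdivlMr// mul1r.
    by rewrite /harmonic/= ler_pdivlMr// mulrC ler_pdivrMr// tK.
  rewrite -mulr_sumr ler_wpM2l//; first by rewrite mulr_ge0 ?invr_ge0// ltW.
  apply: le_trans (yA n); have [Nn|nN] := leqP N n.
    by rewrite [leRHS](big_cat_nat _ Nn)//= lerDr sumr_ge0.
  by rewrite /= big_geq ?sumr_ge0// ltnW.
apply/cvgr0Pnorm_lt => e e0.
have := cubel; rewrite l0 => /cvgr0Pnorm_lt /(_ (e ^+ 3)).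
rewrite exprn_gt0// => /(_ isT); apply: filterS => n.
by rewrite /cube normrX ltr_pXn2r ?nnegrE// ltW.
Qed.

(** * The simplex and the limit point *)

Lemma simplex_le1 (R : realType) (m : nat) (x : 'I_m -> R) (I : {set 'I_m}) :
  in_simplex x -> \sum_(i in I) x i <= 1.
Proof.
case=> x0 <-; rewrite [leRHS](bigID (mem I))/= lerDl.
by apply: sumr_ge0 => i _; exact: x0.
Qed.

Lemma hypergraph_dim_gt0 (m : nat) (E : {set {set 'I_m}}) :
  is_hypergraph E -> (0 < m)%N.
Proof.
case=> /card_gt0P[I IE] [/(_ I IE)/card_gt0P[i _] _].
by case: m i {E I IE} => [[]|].
Qed.

Lemma continuous_coord_sum (R : realType) (m : nat) (P : pred 'I_m) :
  continuous (fun x : 'rV[R]_m => \sum_(i | P i) x ord0 i).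
Proof.
apply: continuous_big => [|i _]; last exact: coord_continuous.
by move=> x; exact: add_continuous.
Qed.

Lemma compact_simplex (R : realType) (m : nat) :
  compact [set x : 'rV[R]_m | in_simplex (x ord0)].
Proof.
have -> : [set x : 'rV[R]_m | in_simplex (x ord0)] =
    [set x : 'rV[R]_m | forall i, `[0, 1]%classic (x ord0 i)] `&`
    [set x : 'rV[R]_m | \sum_i x ord0 i = 1].
  apply/seteqP; split => [x xs|x [x01 x1]]; last first.
    by split=> // i; have := x01 i; rewrite /= in_itv/= => /andP[].
  split; last exact: xs.2.
  move=> i /=; rewrite in_itv/= xs.1/=.
  by have := simplex_le1 [set i] xs; rewrite big_set1.
apply: compact_closedI.
  exact: (@rV_compact R m (fun=> `[0, 1]%classic) (fun=> @segment_compact R 0 1)).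
apply: (@preimage_closed _ _ (fun x : 'rV[R]_m => \sum_i x ord0 i) [set 1]);
  last exact: closed_eq.
by move=> x _; exact: continuous_coord_sum.
Qed.

(* The last clause is the Kuhn-Tucker condition for maximising [\sum_I ln x_I]. *)
Definition log_optimal (R : realType) (m : nat) (E : {set {set 'I_m}}) (v : 'I_m -> R) :=
  [/\ in_simplex v, forall I, I \in E -> 0 < \sum_(i in I) v i &
    forall x, in_simplex x ->
      \sum_(I in E) (\sum_(i in I) x i) / (\sum_(i in I) v i) <= #|E|%:R].

(** [v] maximises [F] over the compact simplex. Since [F] is positive at the barycentre [u], it is
    positive at [v], so no factor vanishes there; the last clause says that the derivative of
    [F / F v] at [v] towards [x] is nonpositive. *)
Lemma exists_log_optimal (R : realType) (m : nat) (E : {set {set 'I_m}}) :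
  is_hypergraph E -> exists v : 'I_m -> R, log_optimal E v.
Proof.
move=> hE; have m0 := hypergraph_dim_gt0 hE.
pose S := [set x : 'rV[R]_m | in_simplex (x ord0)].
pose F (x : 'rV[R]_m) := \prod_(I in E) \sum_(i in I) x ord0 i.
pose u : 'rV[R]_m := const_mx m%:R^-1.
have uS : S u.
  split=> [i|]; first by rewrite mxE invr_ge0.
  under eq_bigr do rewrite mxE.
  by rewrite sumr_const card_ord -[LHS]mulr_natr mulVf// pnatr_eq0 -lt0n.
have Fu : 0 < F u.
  apply: prodr_gt0 => I IE; under eq_bigr do rewrite mxE.
  by rewrite sumr_const pmulrn_lgt0 ?invr_gt0 ?ltr0n//; exact: hE.2.1.
have [||v /set_mem vS vmax] := @EVT_max_rV _ _ F S _ (compact_simplex (m := m)).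
- by exists u.
- apply: continuous_subspaceT; apply: continuous_big => [|I _].
    by move=> x; exact: mul_continuous.
  exact: continuous_coord_sum.
exists (v ord0).
have Fv : 0 < F v by apply: lt_le_trans (vmax u _) => //; exact: mem_set.
have vI0 I : I \in E -> 0 < \sum_(i in I) v ord0 i.
  move=> IE; rewrite lt0r sumr_ge0 ?andbT; last by move=> i _; exact: vS.1.
  move: (gt_eqF Fv); rewrite /F; apply: contraFN => vI.
  by rewrite (bigD1 I)//= (eqP vI) mul0r.
split=> // x xS; rewrite -subr_le0 -sumr_const -sumrB.
rewrite -big_enum.
apply: sum_le0_prod1DM_le1 => t /andP[t0 t1].
pose z := v + t *: (\row_i x i - v).
have zS : S z.
  split=> [i|].
    rewrite !mxE; have -> : v ord0 i + t * (x i - v ord0 i) =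
      (1 - t) * v ord0 i + t * x i by ring.
    by rewrite addr_ge0// mulr_ge0 ?subr_ge0//; [exact: vS.1|exact: xS.1].
  under eq_bigr do rewrite !mxE.
  by rewrite big_split/= -mulr_sumr sumrB vS.2 xS.2 subrr mulr0 addr0.
have -> : \prod_(I <- enum E) (1 + t *
    ((\sum_(i in I) x i) / (\sum_(i in I) v ord0 i) - 1)) = F z / F v.
  rewrite big_enum -prodf_div; apply: eq_bigr => I IE.
  have -> : \sum_(i in I) z ord0 i = \sum_(i in I) v ord0 i +
      t * (\sum_(i in I) x i - \sum_(i in I) v ord0 i).
    by under eq_bigr do rewrite !mxE; rewrite big_split/= -mulr_sumr sumrB.
  by field; rewrite gt_eqF// vI0.
by rewrite ler_pdivrMr// mul1r; exact/vmax/mem_set.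
Qed.

(** * Recovering a vector from its hyperedge sums *)

(** A column of ones beside the transposed incidence matrix encodes the constraint defining the
    space of zero-sum vectors. The kernel condition makes [M] row-free, hence right-invertible, and
    the column of ones contributes nothing when [w] sums to 0. *)
Lemma kernel_trivial_left_inverse (R : realType) (m : nat) (E : {set {set 'I_m}}) :
  kernel_trivial R E -> exists a : {set 'I_m} -> 'I_m -> R,
    forall w : 'I_m -> R, \sum_i w i = 0 ->
    forall i, w i = \sum_(I in E) (\sum_(j in I) w j) * a I i.
Proof.
move=> kerE.
(* Columns range over all subsets; those outside [E] are zero. *)
pose Inc : 'M[R]_(m, #|{set 'I_m}|) :=
  \matrix_(j, k) ((enum_val k \in E) && (j \in enum_val k))%:R.
pose M : 'M[R]_(m, 1 + #|{set 'I_m}|) := row_mx (const_mx 1) Inc.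
have mulInc (u : 'rV[R]_m) k : (u *m Inc) ord0 k =
    if enum_val k \in E then \sum_(j in enum_val k) u ord0 j else 0.
  rewrite mxE; case: ifPn => kE; last first.
    by rewrite big1// => j _; rewrite mxE (negbTE kE) mulr0.
  rewrite [RHS]big_mkcond/=; apply: eq_bigr => j _; rewrite mxE kE/=.
  by case: (j \in _); rewrite ?mulr1 ?mulr0.
have mul1 (u : 'rV[R]_m) : (u *m const_mx 1 : 'M[R]_1) ord0 ord0 = \sum_j u ord0 j.
  by rewrite mxE; apply: eq_bigr => j _; rewrite mxE mulr1.
have Mfree : row_free M.
  apply: inj_row_free => u; rewrite mul_mx_row -row_mx0 => /eq_row_mx[u1 uInc].
  apply/rowP => i; rewrite [RHS]mxE; apply: (kerE (u ord0)).
    by rewrite -mul1 u1 mxE.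
  move=> I IE; have := mulInc u (enum_rank I).
  by rewrite enum_rankK IE uInc mxE.
exists (fun I i => pinvmx M (rshift 1 (enum_rank I)) i) => w w0 i.
pose u : 'rV[R]_m := \row_j w j.
have uw I : \sum_(j in I) u ord0 j = \sum_(j in I) w j.
  by apply: eq_bigr => j _; rewrite mxE.
have -> : w i = (u *m M *m pinvmx M) ord0 i.
  by rewrite -mulmxA mulmxVp// mulmx1 mxE.
rewrite mul_mx_row mxE big_split_ord/= big_ord1 row_mxEl mul1.
have -> : \sum_j u ord0 j = 0 by rewrite -[RHS]w0; apply: eq_bigr => j _; rewrite mxE.
rewrite mul0r add0r [RHS]big_mkcond/= (reindex (@enum_val _ {set 'I_m}))/=; last first.
  by apply: onW_bij; exact: enum_val_bij.
apply: eq_bigr => k _; rewrite row_mxEr mulInc enum_valK uw.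
by case: ifP; rewrite ?mul0r.
Qed.

(** * The law of the choices made in one step *)

(** Coordinate [i0] of a product law has law [p i0]: [h] is absorbed into the factor [i0], the sum
    of products factorises, and all other factors are 1. *)
Lemma sum_prod_marginal (R : comNzRingType) (I J : finType) (p : I -> J -> R)
    (i0 : I) (h : J -> R) :
  (forall i, \sum_j p i j = 1) ->
  \sum_(f : {ffun I -> J}) (\prod_i p i (f i)) * h (f i0) = \sum_j p i0 j * h j.
Proof.
move=> p1; pose q i j := p i j * (if i == i0 then h j else 1).
transitivity (\sum_(f : {ffun I -> J}) \prod_i q i (f i)).
  apply: eq_bigr => f _; rewrite big_split/=; congr (_ * _).
  by rewrite -big_mkcond/= big_pred1_eq.
rewrite -bigA_distr_bigA (bigD1 i0)//=.
have -> : \prod_(i | i != i0) \sum_j q i j = 1.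
  apply: big1 => i /negbTE i0N.
  by under eq_bigr do rewrite /q i0N mulr1; exact: p1.
by rewrite mulr1; apply: eq_bigr => j _; rewrite /q eqxx.
Qed.

Lemma sum_option (V : nmodType) (T : finType) (F : option T -> V) :
  \sum_o F o = F None + \sum_i F (Some i).
Proof.
rewrite (bigD1 None)//= (reindex_omap (@Some T) id)/=; last by case.
by congr (_ + _); apply: eq_bigl => i; rewrite eqxx.
Qed.

Section choices.
Variables (R : realType) (m : nat) (E : {set {set 'I_m}}).
Implicit Types (b : config m) (c : {ffun {set 'I_m} -> option 'I_m}).

Definition edge_balls b (I : {set 'I_m}) : R := \sum_(i in I) (b i)%:R.
Definition total_balls b : R := \sum_i (b i)%:R.

(** Extends the law of one choice to every subset and every option, with the point mass at [None]
    outside [E], so that a choice function follows a product law over all subsets. *)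
Definition edge_prob b (I : {set 'I_m}) (o : option 'I_m) : R :=
  if I \in E then
    (if o is Some i then if i \in I then (b i)%:R / edge_balls b I else 0 else 0)
  else (o == None)%:R.

Lemma choice_probE b c : choice_prob R E b c =
  \prod_(I in E) (if c I is Some i then (b i)%:R / edge_balls b I else 0).
Proof.
by rewrite /choice_prob; apply: eq_bigr => I _; case: (c I) => // i; rewrite natr_sum.
Qed.

Lemma choice_prob_ge0 b c : 0 <= choice_prob R E b c.
Proof.
rewrite choice_probE; apply: prodr_ge0 => I _; case: (c I) => // i.
by rewrite divr_ge0// sumr_ge0.
Qed.

(** An invalid choice has a zero factor, so sums over valid choices become sums over all functions,
    to which distributivity applies. *)
Lemma prod_edge_prob b c : \prod_I edge_prob b I (c I) =
  if valid_choice E c then choice_prob R E b c else 0.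
Proof.
case: ifPn => [/forallP vc|].
  rewrite choice_probE [RHS]big_mkcond/=; apply: eq_bigr => I _.
  rewrite /edge_prob; have := vc I; case: ifP => // _; first by case: (c I) => // i ->.
  by move=> /eqP ->.
rewrite negb_forall => /existsP[I nI]; rewrite (bigD1 I)//= /edge_prob.
move: nI; case: ifP => _; last by move=> /negbTE ->; rewrite mul0r.
by case: (c I) => [i /negbTE ->|_]; rewrite mul0r.
Qed.

Definition step_mean (g : config m -> R) b : R :=
  \sum_(c | valid_choice E c) choice_prob R E b c * g (add_balls E b c).

Lemma edge_balls_gt0 b (I : {set 'I_m}) : (forall i, (1 <= b i)%N) -> (0 < #|I|)%N ->
  0 < edge_balls b I.
Proof.
move=> b1 /card_gt0P[i iI]; rewrite /edge_balls (bigD1 i)//= ltr_wpDr ?sumr_ge0//.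
by rewrite ltr0n b1.
Qed.

Hypothesis E0 : forall I, I \in E -> (0 < #|I|)%N.
Variable b : config m.
Hypothesis b1 : forall i, (1 <= b i)%N.

Lemma sum_edge_prob I : \sum_o edge_prob b I o = 1.
Proof.
rewrite /edge_prob; have [IE|_] := boolP (I \in E); last first.
  by rewrite sum_option eqxx big1 ?addr0.
rewrite sum_option/= add0r -big_mkcond/= -mulr_suml divff// gt_eqF//.
by rewrite edge_balls_gt0 ?E0.
Qed.

Lemma sum_choice_prob : \sum_(c | valid_choice E c) choice_prob R E b c = 1.
Proof.
rewrite big_mkcond; under eq_bigr do rewrite -prod_edge_prob.
by rewrite -bigA_distr_bigA big1// => I _; exact: sum_edge_prob.
Qed.

Lemma sum_choice_prob_edge (h : option 'I_m -> R) I : I \in E ->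
  \sum_(c | valid_choice E c) choice_prob R E b c * h (c I) =
  \sum_(i in I) (b i)%:R / edge_balls b I * h (Some i).
Proof.
move=> IE; rewrite big_mkcond/=.
transitivity (\sum_(c : {ffun {set 'I_m} -> option 'I_m})
    (\prod_J edge_prob b J (c J)) * h (c I)).
  by apply: eq_bigr => c _; rewrite prod_edge_prob; case: ifP; rewrite ?mul0r.
rewrite sum_prod_marginal; last exact: sum_edge_prob.
rewrite sum_option/= /edge_prob IE mul0r add0r [RHS]big_mkcond/=.
by apply: eq_bigr => i _; case: ifP; rewrite ?mul0r.
Qed.

End choices.

(** * One-step decrease of the corrected relative entropy *)

(* The term [- N / x] absorbs the second-order error of [ln]. *)
Lemma ln_corrected_increment (R : realType) (x k N : R) :
  0 < x -> 0 <= k <= N ->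
  k / x <= (ln (x + k) - N / (x + k)) - (ln x - N / x).
Proof.
move=> x0 /andP[k0 kN]; have xk0 : 0 < x + k by rewrite ltr_wpDr.
have lnk : k / (x + k) <= ln (x + k) - ln x.
  rewrite -ln_div ?posrE//.
  have : ln (1 + (x / (x + k) - 1)) <= x / (x + k) - 1.
    by apply: le_ln1Dx; rewrite ltrBrDr addNr divr_gt0.
  rewrite addrC subrK ln_div ?posrE// => h.
  rewrite ln_div ?posrE//.
  have -> : k / (x + k) = 1 - x / (x + k) by field; rewrite gt_eqF.
  by lra.
(* The correction gains [N * k / (x * (x + k))], which covers the loss [k ^+ 2 / (x * (x + k))]
   because [k <= N]. *)
have : k / x <= k / (x + k) + N / x - N / (x + k).
  rewrite -subr_ge0.
  have -> : k / (x + k) + N / x - N / (x + k) - k / x = (N - k) * k / (x * (x + k)).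
    by field; rewrite !gt_eqF.
  by rewrite divr_ge0 ?mulr_ge0 ?subr_ge0// ltW.
by lra.
Qed.

Lemma ln_increment_le (R : realType) (x k : R) :
  0 < x -> 0 <= k -> ln (x + k) - ln x <= k / x.
Proof.
move=> x0 k0; rewrite -ln_div ?posrE//; last by rewrite ltr_wpDr.
have -> : (x + k) / x = 1 + k / x by field; rewrite gt_eqF.
by apply: le_ln1Dx; apply: lt_le_trans (_ : 0 <= _); rewrite ?ltrN10// divr_ge0// ltW.
Qed.

Section drift.
Variables (R : realType) (m : nat) (E : {set {set 'I_m}}) (v : 'I_m -> R).
Implicit Types (b : config m) (c : {ffun {set 'I_m} -> option 'I_m}).
Local Notation N := (#|E|%:R : R).

(* Up to the correction [#|E| / b i], the relative entropy of [v] with respect to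
   the proportions of [b] plus a constant. *)
Definition potential b : R :=
  ln (total_balls R b) - \sum_i v i * (ln (b i)%:R - N / (b i)%:R).

Definition dissipation b : R :=
  (total_balls R b)^-1 *
  \sum_(I in E) (edge_balls R b I / total_balls R b - \sum_(i in I) v i) ^+ 2.

Lemma dissipation_ge0 b : 0 <= dissipation b.
Proof.
rewrite mulr_ge0 ?invr_ge0 ?sumr_ge0// => i _; exact: sqr_ge0.
Qed.

Definition gain c i := #|[set I in E | c I == Some i]|.

Lemma gain_le c i : (gain c i <= #|E|)%N.
Proof. by apply/subset_leq_card/fintype.subsetP => I; rewrite inE => /andP[]. Qed.

Lemma gainE c i : (gain c i)%:R = \sum_(I in E) (c I == Some i)%:R :> R.
Proof.
rewrite /gain -sum1_card natr_sum; under eq_bigl do rewrite inE.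
by rewrite big_mkcondr/=; apply: eq_bigr => I _; case: ifP.
Qed.

Lemma add_ballsE b c i : (add_balls E b c i)%:R = (b i)%:R + (gain c i)%:R :> R.
Proof. by rewrite ffunE natrD. Qed.

Lemma edge_balls_add_balls b c I :
  edge_balls R (add_balls E b c) I = edge_balls R b I + \sum_(i in I) (gain c i)%:R.
Proof. by rewrite -big_split/=; apply: eq_bigr => i _; rewrite add_ballsE. Qed.

Lemma sum_gain c : valid_choice E c -> \sum_i (gain c i)%:R = N.
Proof.
move=> /forallP vc; under eq_bigr do rewrite gainE.
rewrite exchange_big/= -sumr_const; apply: eq_bigr => I IE.
have := vc I; rewrite IE; case: (c I) => // i _.
rewrite (bigD1 i)//= eqxx big1 ?addr0// => j /negbTE ji.
by rewrite (inj_eq Some_inj) eq_sym ji.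
Qed.

Lemma total_add_balls b c : valid_choice E c ->
  total_balls R (add_balls E b c) = total_balls R b + N.
Proof.
move=> vc; rewrite -(sum_gain vc) -big_split/=; apply: eq_bigr => i _.
exact: add_ballsE.
Qed.

Hypothesis hE : is_hypergraph E.
Hypothesis vopt : log_optimal E v.
Variable b : config m.
Hypothesis b1 : forall i, (1 <= b i)%N.

Let b0 i : 0 < (b i)%:R :> R. Proof. by rewrite ltr0n b1. Qed.

Lemma total_gt0 : 0 < total_balls R b.
Proof.
have i := Ordinal (hypergraph_dim_gt0 hE).
by rewrite /total_balls (bigD1 i)//= ltr_wpDr ?sumr_ge0.
Qed.

(** The weights [v] sum to 1, each [b i] is at most the total, and the correction only lowers the
    subtracted sum. *)
Lemma potential_ge0 : 0 <= potential b.
Proof.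
case: vopt => -[v0 v1] _ _; rewrite subr_ge0.
have -> : ln (total_balls R b) = \sum_i v i * ln (total_balls R b).
  by rewrite -mulr_suml v1 mul1r.
apply: ler_sum => i _.
rewrite ler_wpM2l//; apply: (@le_trans _ _ (ln (b i)%:R)).
  by rewrite gerBl divr_ge0.
rewrite ler_ln ?posrE// ?total_gt0// /total_balls (bigD1 i)//= lerDl sumr_ge0//.
Qed.

(** The logarithm of the total rises by at most [N / total_balls R b], and each corrected logarithm
    by at least [gain c i / b i]. Splitting the gains by hyperedge leaves terms that depend on a
    single [c I]. *)
Lemma potential_add_balls c : valid_choice E c ->
  potential (add_balls E b c) <= potential b + N / total_balls R b
    - \sum_(I in E) \sum_i (c I == Some i)%:R * (v i / (b i)%:R).
Proof.
case: vopt => -[v0 v1] _ _ vc; rewrite /potential total_add_balls//.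
have lnT := ln_increment_le total_gt0 (ler0n R #|E|).
have : \sum_i v i * ((gain c i)%:R / (b i)%:R) <=
    \sum_i v i * (ln (add_balls E b c i)%:R - N / (add_balls E b c i)%:R) -
    \sum_i v i * (ln (b i)%:R - N / (b i)%:R).
  rewrite -sumrB; apply: ler_sum => i _; rewrite -mulrBr ler_wpM2l//.
  rewrite add_ballsE; apply: ln_corrected_increment => //.
  by rewrite ler0n ler_nat gain_le.
have -> : \sum_i v i * ((gain c i)%:R / (b i)%:R) =
    \sum_(I in E) \sum_i (c I == Some i)%:R * (v i / (b i)%:R).
  rewrite exchange_big/=; apply: eq_bigr => i _.
  by rewrite gainE mulrCA mulr_suml -mulr_suml.
by lra.
Qed.

(** With [x] the proportions and [T] the total of [b], averaging bounds the drift by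
    [T^-1 * \sum_I (1 - v_I / x_I)]. The optimality inequality [\sum_I (x_I / v_I - 1) <= 0] is then
    used to compare with the squares term by term. *)
Lemma potential_drift : step_mean E potential b + dissipation b <= potential b.
Proof.
have [vs vI opt] := vopt.
have E0 := hE.2.1.
have T0 := total_gt0.
have bI0 I : I \in E -> 0 < edge_balls R b I by move=> IE; rewrite edge_balls_gt0 ?E0.
have mean : step_mean E potential b <=
    potential b + N / total_balls R b -
    \sum_(I in E) (\sum_(i in I) v i) / edge_balls R b I.
  apply: le_trans.
    apply: ler_sum => c vc; apply: ler_wpM2l; first exact: choice_prob_ge0.
    exact: potential_add_balls.
  under eq_bigr do rewrite mulrBr mulr_sumr.
  rewrite sumrB -mulr_suml sum_choice_prob// mul1r exchange_big/= lerB//.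
  rewrite le_eqVlt; apply/orP; left; apply/eqP; apply: eq_bigr => I IE.
  (* Vertex [i] is chosen with probability proportional to [b i], which cancels the denominator of
     [v i / b i]. *)
  rewrite (sum_choice_prob_edge E0 b1
    (fun o => \sum_i (o == Some i)%:R * (v i / (b i)%:R)) IE).
  rewrite mulr_suml; apply: eq_bigr => i _.
  have -> : \sum_j (Some i == Some j)%:R * (v j / (b j)%:R) = v i / (b i)%:R.
    rewrite (bigD1 i)//= eqxx mul1r big1 ?addr0// => j /negbTE ji.
    by rewrite (inj_eq Some_inj) eq_sym ji mul0r.
  by field; rewrite !gt_eqF// bI0.
pose x i := (b i)%:R / total_balls R b.
have xs : in_simplex x.
  split=> [i|]; first by rewrite divr_ge0// ltW.
  by rewrite -mulr_suml divff// gt_eqF.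
have sumx (I : {set 'I_m}) : \sum_(i in I) x i = edge_balls R b I / total_balls R b.
  by rewrite mulr_suml.
have := opt x xs; rewrite -sumr_const => {}opt.
suff : dissipation b <=
    \sum_(I in E) (\sum_(i in I) v i) / edge_balls R b I - N / total_balls R b.
  by lra.
have -> : \sum_(I in E) (\sum_(i in I) v i) / edge_balls R b I - N / total_balls R b =
  (total_balls R b)^-1 * (\sum_(I in E) ((\sum_(i in I) v i) / (\sum_(i in I) x i) - 1)).
  rewrite sumrB sumr_const mulrBr mulrC; congr (_ - _).
  rewrite mulr_sumr; apply: eq_bigr => I IE; rewrite sumx.
  by field; rewrite !gt_eqF// bI0.
rewrite ler_pM2l ?invr_gt0//.
rewrite -subr_le0 -sumrB in opt.
rewrite -subr_ge0 -sumrB; apply: le_trans (_ : _ <= - _) _.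
  by rewrite oppr_ge0; exact: opt.
rewrite -subr_ge0 opprK -big_split/=; apply: sumr_ge0 => I IE.
rewrite -sumx.
have := simplex_le1 I xs; have := simplex_le1 I vs; have := vI I IE.
have : 0 < \sum_(i in I) x i by rewrite sumx divr_gt0 ?bI0.
set X := \sum_(i in I) x i; set V := \sum_(i in I) v i => X0 V0 V1 X1.
(* Here [V / X + X / V - 2 = (X - V) ^+ 2 / (X * V)], and [X * V <= 1] in the simplex. *)
have -> : V / X - 1 - (X - V) ^+ 2 + (X / V - 1) =
  (X - V) ^+ 2 * ((X * V)^-1 - 1) by field; rewrite !gt_eqF.
rewrite mulr_ge0 ?sqr_ge0// subr_ge0 invf_ge1 ?mulr_gt0//.
by rewrite mulr_ile1// ltW.
Qed.

End drift.

(** * Random variables with countably many values *)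

Section countable_valued.
Context d (T : measurableType d) (R : realType) (S : countType) (X : T -> S).
Variable P : {measure set T -> \bar R}.
Hypothesis mX : forall s, measurable [set w | X w = s].

Lemma measurable_countable_preimage (A : set S) : measurable (X @^-1` A).
Proof.
have -> : X @^-1` A = \bigcup_(s in A) [set w | X w = s].
  apply/seteqP; split => [w Aw|w [s As /= Xs]]; first by exists (X w).
  by rewrite /preimage/= Xs.
rewrite bigcup_mkcond; apply: countable_bigcupT_measurable => // s.
by case: ifP.
Qed.

Lemma measurable_fun_countable d' (U : measurableType d') (g : S -> U) :
  measurable_fun setT (g \o X).
Proof.
move=> _ Y _; rewrite setTI; exact: (measurable_countable_preimage (g @^-1` Y)).
Qed.

(** The fibres on which [Q] fails are null, and [unpickle] enumerates them. *)
Lemma ae_countable (Q : S -> Prop) :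
  (forall s, P [set w | X w = s] = 0%E \/ Q s) -> {ae P, forall w, Q (X w)}.
Proof.
move=> PQ.
have : {ae P, forall w, forall k : nat, forall s, unpickle k = Some s -> X w = s -> Q s}.
  apply: ae_foralln => k; case: (unpickle k) => [s|]; last by apply: aeW.
  have [Ps0|Qs] := PQ s; last by apply: aeW => w _ [<-].
  exists [set w | X w = s]; split=> // w /=; apply: contra_notP => Xws t [<-].
  by move=> /Xws.
by apply: filterS => w /(_ (pickle (X w)) (X w)); rewrite pickleK; apply.
Qed.

(** The fibres of [X] form a countable measurable partition; comparing integrals on each of them
    plays the role of conditioning on [X]. *)
Lemma eq_integral_fibers (F G : T -> \bar R) :
  measurable_fun setT F -> measurable_fun setT G ->
  (forall w, (0 <= F w)%E) -> (forall w, (0 <= G w)%E) ->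
  (forall s, \int[P]_(w in [set w | X w = s]) F w =
             \int[P]_(w in [set w | X w = s]) G w)%E ->
  (\int[P]_w F w = \int[P]_w G w)%E.
Proof.
move=> mF mG F0 G0 FG.
pose D k := X @^-1` [set s | pickle s = k].
have mD k : measurable (D k) by exact: measurable_countable_preimage.
have DT : \bigcup_k D k = setT.
  by apply/seteqP; split=> // w _; exists (pickle (X w)).
have tD : trivIset setT D.
  by move=> i j _ _ [w [<- <-]].
rewrite -DT !ge0_integral_bigcup ?DT//; apply: eq_eseriesr => k _.
have [[s sk]|nk] := pselect (exists s : S, pickle s = k).
  suff -> : D k = [set w | X w = s] by exact: FG.
  apply/seteqP; split=> w /=; rewrite /D/= -sk; last by move=> ->.
  exact: (pcan_inj pickleK).
suff -> : D k = set0 by rewrite !integral_set0.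
by rewrite -subset0 => w Dw; apply: nk; exists (X w).
Qed.

End countable_valued.

(** * The urn as a Markov chain *)

Section urn_process.
Context (R : realType) d (T : measurableType d) (P : probability T R).
Variables (m : nat) (E : {set {set 'I_m}}) (B0 : config m) (B : nat -> T -> config m).
Hypothesis urn : is_polya_urn P E B0 B.

(** The past up to time [n] as one random variable with values in a countable type. *)
Definition history n w := [seq B k w | k <- iota 0 n.+1].

Lemma nth_history n w k : (k <= n)%N -> nth B0 (history n w) k = B k w.
Proof. by move=> kn; rewrite (nth_map 0%N) ?size_iota// nth_iota. Qed.

Lemma history_fiber n s : [set w | history n w = s] =
  if size s == n.+1 then [set w | forall k, (k <= n)%N -> B k w = nth B0 s k] else set0.
Proof.
have szh w : size (history n w) = n.+1 by rewrite size_map size_iota.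
case: ifPn => [/eqP szs|szs].
  apply/seteqP; split=> w /= => [<- k kn|Bs]; first by rewrite nth_history.
  apply: (@eq_from_nth _ B0) => [|k]; rewrite szh ?szs// => kn.
  by rewrite nth_history ?Bs.
by rewrite -subset0 => w /= hs; move/eqP: szs; rewrite -hs szh.
Qed.

Lemma measurable_history n s : measurable [set w | history n w = s].
Proof.
rewrite history_fiber; case: ifP => // _.
rewrite (_ : mkset _ = \bigcap_(k in [set k | (k <= n)%N])
  [set w | B k w = nth B0 s k]); last by [].
apply: bigcap_measurable; first by exists 0%N.
by move=> k _; exact: urn.1.
Qed.

Lemma history_succ n s b : size s = n.+1 ->
  [set w | history n w = s] `&` [set w | B n.+1 w = b] =
  [set w | history n.+1 w = rcons s b].
Proof.
move=> szs; apply/seteqP.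
have hS w : history n.+1 w = rcons (history n w) (B n.+1 w).
  by rewrite /history -[n.+2]addn1 iotaD map_cat/= cats1.
split=> w /=; rewrite hS; first by case=> -> ->.
by move=> /rcons_inj[].
Qed.

(** Markov property in product form: the path law up to [n.+1] has one factor more than the law up
    to [n]. *)
Lemma prob_history_succ n s b : size s = n.+1 ->
  P ([set w | history n w = s] `&` [set w | B n.+1 w = b]) =
  (P [set w | history n w = s] * (urn_trans R E (nth B0 s n) b)%:E)%E.
Proof.
move=> szs; rewrite history_succ// !history_fiber size_rcons szs !eqxx !urn.2.
rewrite -EFinM big_ord_recr/= !nth_rcons szs ltnn eqxx ltnSn -!mulrA.
congr (_ * (_ * _))%:E; apply: eq_bigr => k _.
by rewrite !nth_rcons szs !ltnS ltnW ltn_ord.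
Qed.

(** Only the laws are prescribed, so impossible moves are excluded up to a null set: a history
    ending with one has a zero transition factor. *)
Lemma ae_urn_path : {ae P, forall w, B 0%N w = B0 /\
  forall n, exists2 c, valid_choice E c & B n.+1 w = add_balls E (B n w) c}.
Proof.
have h0 : {ae P, forall w, nth B0 (history 0 w) 0 = B0}.
  apply: (@ae_countable _ _ _ _ _ _ (@measurable_history 0)
    (fun s => nth B0 s 0 = B0)) => s.
  have [->|nsB] := eqVneq (nth B0 s 0) B0; [by right|left].
  rewrite history_fiber; case: ifP => [_|_]; last exact: measure0.
  by apply: etrans (urn.2 0 (nth B0 s)) _; rewrite (negbTE nsB) mul0r.
have hS : {ae P, forall w n, exists2 c, valid_choice E c &
    nth B0 (history n.+1 w) n.+1 = add_balls E (nth B0 (history n.+1 w) n) c}.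
  apply: ae_foralln => n.
  apply: (@ae_countable _ _ _ _ _ _ (@measurable_history n.+1) (fun s =>
    exists2 c, valid_choice E c & nth B0 s n.+1 = add_balls E (nth B0 s n) c)) => s.
  have [ex|nex] := pselect (exists2 c, valid_choice E c &
    nth B0 s n.+1 = add_balls E (nth B0 s n) c); [by right|left].
  rewrite history_fiber; case: ifP => [_|_]; last exact: measure0.
  apply: etrans (urn.2 n.+1 (nth B0 s)) _; rewrite big_ord_recr/=.
  suff -> : urn_trans R E (nth B0 s n) (nth B0 s n.+1) = 0 by rewrite !mulr0.
  apply: big1 => c /andP[vc /eqP ac]; by case: nex; exists c.
apply: filterS2 h0 hS => w; rewrite nth_history// => B00 hS; split=> // n.
by have := hS n; rewrite !nth_history.
Qed.

(** As [config m] is in general infinite, targets are summed over a finite list holding all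
    configurations reachable in one step. *)
Lemma sum_urn_trans (g : config m -> R) b (s : seq (config m)) :
  uniq s -> (forall c, valid_choice E c -> add_balls E b c \in s) ->
  \sum_(b' <- s) g b' * urn_trans R E b b' = step_mean E g b.
Proof.
move=> us sP; under eq_bigr do rewrite mulr_sumr big_mkcondr.
rewrite exchange_big/=; apply: eq_bigr => c vc.
rewrite (bigD1_seq _ (sP c vc) us)/= eqxx mulrC big1 ?addr0// => b' /negbTE ne.
by rewrite eq_sym ne.
Qed.

Lemma integral_urn_step (g : config m -> R) n : (forall b, 0 <= g b) ->
  (\int[P]_w (g (B n.+1 w))%:E = \int[P]_w (step_mean E g (B n w))%:E)%E.
Proof.
move=> g0.
have mean0 b : 0 <= step_mean E g b.
  by apply: sumr_ge0 => c _; rewrite mulr_ge0// choice_prob_ge0.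
have mB (h : config m -> R) k : measurable_fun setT (fun w => (h (B k w))%:E).
  exact: (measurable_fun_countable (urn.1 k) (fun b => (h b)%:E)).
apply: (eq_integral_fibers (X := history n) (@measurable_history n)) => //.
- by move=> w; rewrite lee_fin.
- by move=> w; rewrite lee_fin.
move=> s; have mD := @measurable_history n s.
have [szs|szs] := eqVneq (size s) n.+1; last first.
  by rewrite history_fiber (negbTE szs) !integral_set0.
set D := [set w | history n w = s] in mD *.
have BD w : D w -> B n w = nth B0 s n by rewrite /D/= => <-; rewrite nth_history.
set b := nth B0 s n in BD.
pose L := undup [seq add_balls E b c | c <- enum (valid_choice E)].
have LP c : valid_choice E c -> add_balls E b c \in L.
  by move=> vc; rewrite mem_undup; apply/map_f; rewrite mem_enum.
rewrite [RHS](eq_integral (cst (step_mean E g b)%:E)); last first.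
  by move=> w /set_mem /BD ->.
rewrite integral_cst//.
(* On [D], almost surely [B n.+1] lies in the finite list [L], so the integrand is a finite
   combination of indicators. *)
transitivity (\int[P]_(w in D) (\sum_(b' <- L) (g b' * (B n.+1 w == b')%:R)%:E))%E.
  apply: ae_eq_integral => //.
  - exact: measurable_funTS.
  - apply: emeasurable_sum => b'; apply: measurable_funTS.
    exact: (mB (fun x => g b' * (x == b')%:R)).
  apply: filterS ae_urn_path => w [_ /(_ n)[c vc Bc]] Dw.
  rewrite sumEFin; congr EFin.
  rewrite (bigD1_seq (B n.+1 w)) ?undup_uniq//= ?eqxx ?mulr1; last first.
    by rewrite Bc BD// LP.
  by rewrite big1 ?addr0// => b' /negbTE ne; rewrite eq_sym ne mulr0.
rewrite ge0_integral_sum//; last 2 first.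
- by move=> b'; apply: measurable_funTS; exact: (mB (fun x => g b' * (x == b')%:R)).
- by move=> b' w _; rewrite lee_fin mulr_ge0.
rewrite -(sum_urn_trans g (undup_uniq _) LP) -sumEFin.
rewrite ge0_sume_distrl//; last first.
  move=> b' _; rewrite lee_fin mulr_ge0//.
  by apply: sumr_ge0 => c _; exact: choice_prob_ge0.
apply: eq_bigr => b' _.
rewrite EFinM -muleA [X in (_ * X)%E]muleC -prob_history_succ//.
under eq_integral do rewrite EFinM.
rewrite ge0_integralZl//; last 2 first.
- by apply: measurable_funTS; exact: (mB (fun x => (x == b')%:R)).
- by rewrite lee_fin.
congr (_ * _)%E; rewrite setIC -integral_indic//; last exact: urn.1.
apply: eq_integral => w _; rewrite indicE.
suff -> : (w \in [set w | B n.+1 w = b']) = (B n.+1 w == b') by [].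
by apply/idP/eqP => [/set_mem|]//; exact: mem_set.
Qed.

End urn_process.

(** * Deterministic analysis of a single urn path *)

Section urn_path.
Variables (R : realType) (m : nat) (E : {set {set 'I_m}}) (v : 'I_m -> R).
Variables (B0 : config m) (B : nat -> config m).
Hypothesis hE : is_hypergraph E.
Hypothesis B0_ge1 : forall i, (1 <= B0 i)%N.
Hypothesis B_0 : B 0%N = B0.
Hypothesis B_S : forall n, exists2 c, valid_choice E c & B n.+1 = add_balls E (B n) c.
Local Notation N := (#|E|%:R : R).

Lemma urn_path_ge1 n i : (1 <= B n i)%N.
Proof.
elim: n => [|n IH]; first by rewrite B_0.
by have [c _ ->] := B_S n; rewrite ffunE ltn_addr.
Qed.

Lemma urn_path_total n : total_balls R (B n) = total_balls R B0 + n%:R * N.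
Proof.
elim: n => [|n IH]; first by rewrite B_0 mul0r addr0.
by have [c vc ->] := B_S n; rewrite total_add_balls// IH -natr1; ring.
Qed.

Lemma urn_path_total_gt0 n : 0 < total_balls R (B n).
Proof. by apply: (total_gt0 _ hE) => i; exact: urn_path_ge1. Qed.

Lemma urn_path_simplex n :
  in_simplex (fun i => (B n i)%:R / total_balls R (B n)).
Proof.
have T0 := urn_path_total_gt0 n; split=> [i|]; first by rewrite divr_ge0// ltW.
by rewrite -mulr_suml divff// gt_eqF.
Qed.

Lemma urn_xE n i : urn_x R E B0 (B n) n i = (B n i)%:R / total_balls R (B n).
Proof.
rewrite /urn_x urn_path_total; congr (_ / _).
by rewrite natrD natrM /total_balls natr_sum.
Qed.

Lemma sum_urn_path n (I : {set 'I_m}) :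
  \sum_(i in I) (B n i)%:R / total_balls R (B n) =
  edge_balls R (B n) I / total_balls R (B n).
Proof. by rewrite mulr_suml. Qed.

(** If [I] receives [k] balls and had fraction [p], the change is [k - N * p] over the new total,
    with [k] in [[0, N]] and [p] in [[0, 1]]. *)
Lemma edge_fraction_increment n (I : {set 'I_m}) :
  `|edge_balls R (B n.+1) I / total_balls R (B n.+1) -
    edge_balls R (B n) I / total_balls R (B n)| <= N / total_balls R (B n.+1).
Proof.
have T0 := urn_path_total_gt0 n; have T1 := urn_path_total_gt0 n.+1.
have := simplex_le1 I (urn_path_simplex n); rewrite sum_urn_path.
have [c vc eqB] := B_S n.
have TE : total_balls R (B n.+1) = total_balls R (B n) + N by rewrite eqB total_add_balls.
have := esym (edge_balls_add_balls R E (B n) c I); rewrite -eqB.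
set k := \sum_(i in I) _ => bI.
have k0 : 0 <= k by apply: sumr_ge0.
have kN : k <= N.
  by rewrite -(sum_gain R vc) [leRHS](bigID (mem I))/= lerDl sumr_ge0.
have : 0 <= edge_balls R (B n) I / total_balls R (B n).
  by rewrite divr_ge0 ?sumr_ge0// ltW.
rewrite -bI; set p := _ / total_balls R (B n) => p0 p1.
have -> : (edge_balls R (B n) I + k) / total_balls R (B n.+1) - p =
    (k - N * p) / total_balls R (B n.+1).
  by rewrite TE /p; field; rewrite -?TE !gt_eqF.
rewrite normrM [X in _ * X]gtr0_norm ?invr_gt0// ler_pM2r ?invr_gt0// ler_norml.
have N0 : 0 <= N by [].
by apply/andP; split; nra.
Qed.

Lemma urn_path_cvg (A : R) : kernel_trivial R E -> in_simplex v ->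
  (forall n, \sum_(0 <= k < n) dissipation E v (B k) <= A) ->
  forall i, (fun n => urn_x R E B0 (B n) n i) @ \oo --> v i.
Proof.
move=> kerE vs dA i.
pose y I n := edge_balls R (B n) I / total_balls R (B n) - \sum_(j in I) v j.
have y0 (I : {set 'I_m}) : I \in E -> y I @ \oo --> 0.
  move=> IE.
  (* The total after [n] steps is [T0 + n * N <= (T0 + N) * n.+1], where [T0] is the initial
     total. *)
  apply: (@cvg0_weighted_square_sum _ _ (fun n => total_balls R (B n)) A N
    (total_balls R B0 + N)) => n.
  - exact: urn_path_total_gt0.
  - rewrite urn_path_total -natr1 mulrDr mulr1 mulrDl.
    have := urn_path_total_gt0 0; rewrite B_0 => T0.
    have := ler0n R n; have := ler0n R #|E|; nra.
  - have xs := urn_path_simplex n.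
    have := simplex_le1 I xs; have := simplex_le1 I vs; rewrite sum_urn_path.
    have : 0 <= \sum_(j in I) v j by apply: sumr_ge0 => j _; exact: vs.1.
    have : 0 <= \sum_(j in I) (B n j)%:R / total_balls R (B n).
      by apply: sumr_ge0 => j _; exact: xs.1.
    rewrite sum_urn_path /y ler_norml => ? ? ? ?; apply/andP; split; lra.
  - rewrite /y opprB addrA subrK.
    apply: le_trans (edge_fraction_increment n I) _.
    rewrite ler_wpM2l// lef_pV2 ?posrE ?urn_path_total_gt0//.
    by rewrite !urn_path_total lerD2l ler_wpM2r// ler_nat.
  - by rewrite /y opprB addrA subrK; exact: edge_fraction_increment.
  - apply: le_trans (dA n); apply: ler_sum => k _.
    rewrite /dissipation mulrC ler_pM2l ?invr_gt0 ?urn_path_total_gt0//.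
    by rewrite (bigD1 I)//= lerDl sumr_ge0// => J _; exact: sqr_ge0.
have [a aE] := kernel_trivial_left_inverse kerE.
have xE n : urn_x R E B0 (B n) n i = v i + \sum_(I in E) y I n * a I i.
  have xs := urn_path_simplex n.
  (* The left inverse applies to [x(n) - v], a difference of two simplex points and so of zero
     sum. *)
  have := aE (fun j => (B n j)%:R / total_balls R (B n) - v j).
  rewrite sumrB xs.2 vs.2 subrr => /(_ erefl i).
  under eq_bigr do rewrite sumrB sum_urn_path.
  by move=> <-; rewrite urn_xE; ring.
under eq_fun do rewrite xE.
suff sum0 : (fun n => \sum_(I in E) y I n * a I i) @ \oo --> 0.
  suff : (fun n => v i + \sum_(I in E) y I n * a I i) @ \oo --> v i + 0.
    by rewrite addr0.
  by apply: cvgD => //; exact: cvg_cst.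
suff : (fun n => \sum_(I in E) y I n * a I i) @ \oo --> \sum_(I in E) 0 * a I i.
  have -> : \sum_(I in E) 0 * a I i = 0 by rewrite big1// => I _; rewrite mul0r.
  by [].
apply: cvg_big => [|I IE]; first exact: add_continuous.
by apply: cvgM; [exact: y0|exact: cvg_cst].
Qed.

End urn_path.

(** * Almost sure summability of the dissipation *)

Section urn_convergence.
Context (R : realType) d (T : measurableType d) (P : probability T R).
Variables (m : nat) (E : {set {set 'I_m}}) (v : 'I_m -> R).
Variables (B0 : config m) (B : nat -> T -> config m).
Hypothesis hE : is_hypergraph E.
Hypothesis vopt : log_optimal E v.
Hypothesis B0_ge1 : forall i, (1 <= B0 i)%N.
Hypothesis urn : is_polya_urn P E B0 B.

(* [potential] can be negative at configurations with an empty vertex. *)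
Let V b : R := Num.max 0 (potential E v b).

Let V_ge0 b : 0 <= V b. Proof. by rewrite le_max lexx. Qed.

Let measurable_fun_B (h : config m -> R) k :
  measurable_fun setT (fun w => (h (B k w))%:E).
Proof. exact: (measurable_fun_countable (urn.1 k) (fun b => (h b)%:E)). Qed.

Let V_drift (b : config m) : (forall i, (1 <= b i)%N) ->
  step_mean E V b + dissipation E v b <= V b.
Proof.
move=> b1; have VE (b' : config m) : (forall i, (1 <= b' i)%N) -> V b' = potential E v b'.
  by move=> ?; rewrite /V max_r// potential_ge0.
rewrite VE//; apply: le_trans (potential_drift hE vopt b1).
rewrite lerD2r; apply: ler_sum => c _; rewrite VE// => i.
by rewrite ffunE ltn_addr.
Qed.

(** Supermartingale inequality in expectation. The drift bound needs nonempty vertices, which almost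
    every path has at all times. *)
Lemma integral_V_step n :
  (\int[P]_w (V (B n.+1 w))%:E + \int[P]_w (dissipation E v (B n w))%:E <=
   \int[P]_w (V (B n w))%:E)%E.
Proof.
have mean0 b : 0 <= step_mean E V b.
  by apply: sumr_ge0 => c _; rewrite mulr_ge0// choice_prob_ge0.
rewrite (integral_urn_step urn)// -ge0_integralD//; last 2 first.
- by move=> w _; rewrite lee_fin.
- by move=> w _; rewrite lee_fin dissipation_ge0.
apply: ae_ge0_le_integral => //.
- by move=> w _; rewrite -EFinD lee_fin addr_ge0// dissipation_ge0.
- exact: (measurable_fun_B (fun b => step_mean E V b + dissipation E v b)).
- by move=> w _; rewrite lee_fin.
apply: filterS (ae_urn_path urn) => w [B00 BS] _; rewrite -EFinD lee_fin.
by apply: V_drift => i; exact: (urn_path_ge1 B0_ge1 B00 BS).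
Qed.

Lemma sum_integral_dissipation n :
  (\sum_(0 <= k < n) \int[P]_w (dissipation E v (B k w))%:E <= (V B0)%:E)%E.
Proof.
have dint0 k : (0 <= \int[P]_w (dissipation E v (B k w))%:E)%E.
  by apply: integral_ge0 => w _; rewrite lee_fin dissipation_ge0.
have Vint0 k : (0 <= \int[P]_w (V (B k w))%:E)%E.
  by apply: integral_ge0 => w _; rewrite lee_fin.
(* The telescoping induction keeps the term at time [n], dropped at the end as nonnegative. *)
suff H : (\int[P]_w (V (B n w))%:E +
    \sum_(0 <= k < n) \int[P]_w (dissipation E v (B k w))%:E <= (V B0)%:E)%E.
  by apply: le_trans H; rewrite leeDr.
elim: n => [|n IH].
  rewrite big_nil adde0.
  have -> : (V B0)%:E = (\int[P]_w (cst (V B0)%:E w))%E.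
    by rewrite integral_cst// [X in (_ * X)%E](@probability_setT _ _ _ P) mule1.
  apply: ae_ge0_le_integral => //.
  - by move=> w _; rewrite lee_fin.
  - by move=> w _; rewrite lee_fin.
  by apply: filterS (ae_urn_path urn) => w [-> _].
rewrite big_nat_recr//= addeCA addeC; apply: le_trans IH.
by rewrite leeD2r// integral_V_step.
Qed.

(** Exchanging sum and integral, the full series has integral at most [V B0]; it is therefore finite
    almost surely, and its value serves as [A]. *)
Lemma ae_sum_dissipation_bounded :
  {ae P, forall w, exists A, forall n,
    \sum_(0 <= k < n) dissipation E v (B k w) <= A}.
Proof.
pose S w := (\sum_(0 <= k <oo) (dissipation E v (B k w))%:E)%E.
have d0 w k : (0 <= (dissipation E v (B k w))%:E)%E by rewrite lee_fin dissipation_ge0.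
have S0 w : (0 <= S w)%E by apply: nneseries_ge0.
have mS : measurable_fun setT S.
  by apply: ge0_emeasurable_sum => // k _; exact: measurable_fun_B.
have intS : (\int[P]_w S w <= (V B0)%:E)%E.
  rewrite integral_nneseries//.
  apply: lime_le; first by apply: is_cvg_nneseries => *; exact: integral_ge0.
  by apply: nearW => n; exact: sum_integral_dissipation.
have iS : P.-integrable setT S.
  apply/integrableP; split=> //.
  under eq_integral do rewrite gee0_abs//.
  by apply: le_lt_trans intS _; rewrite ltry.
apply: filterS (integrable_ae measurableT iS) => w /(_ Logic.I) Sfin.
exists (fine (S w)) => n.
by rewrite -lee_fin fineK// -sumEFin; apply: nneseries_lim_ge => k _ _; exact: d0.
Qed.

End urn_convergence.

Theorem theorem1 (R : realType) (m : nat) (E : {set {set 'I_m}}) :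
  is_hypergraph E -> kernel_trivial R E ->
  exists v : 'I_m -> R, in_simplex v /\
    forall (B0 : config m), (forall i, (1 <= B0 i)%N) ->
    forall (d : measure_display) (T : measurableType d) (P : probability T R)
           (B : nat -> T -> config m),
      is_polya_urn P E B0 B ->
      {ae P, forall w, forall i : 'I_m,
          (fun n => urn_x R E B0 (B n w) n i) @ \oo --> v i}.
Proof.
move=> hE kerE; have [v vopt] := exists_log_optimal R hE.
have [vs _ _] := vopt; exists v; split=> // B0 B01 d T P B urn.
(* Both properties hold almost surely; where both hold, the path argument is deterministic. *)
apply: filterS2 (ae_urn_path urn) (ae_sum_dissipation_bounded hE vopt B01 urn).
by move=> w [B00 BS] [A dA] i; apply: (urn_path_cvg hE B01 B00 BS kerE vs dA).
Qed.
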